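(* Let $\{\mathbb{X}_n\}_{n\in\mathbb{N}}$ be a sequence of Banach spaces over $\mathbb{K}$ such that $\mathcal{D}(\mathbb{X}_n)=2-\frac1n$ for every $n\in\mathbb{N}$. Then for any $p\in(1,\infty)$, $D(x)<2$ for every non-zero $x\in\bigoplus_p\mathbb{X}_n$, but $\mathcal{D}\left(\bigoplus_p\mathbb{X}_n\right)=2$.
   Context: $\mathbb{K}=\mathbb{R}$ or $\mathbb{C}$. For $1\le p<\infty$, $\bigoplus_p\mathbb{X}_n$ is the space of sequences $\{x_n\}$ with $x_n\in\mathbb{X}_n$ and $\sum_n\|x_n\|^p<\infty$, with norm $\|\{x_n\}\|_p=(\sum_n\|x_n\|^p)^{1/p}$. For a non-zero $x$ in a normed space $\mathbb{X}$, $J(x)=\{f\in\mathbb{X}^*:\|f\|=1,\ f(x)=\|x\|\}$, $D(x)=\operatorname{diam}(J(x))$ (diameter in the norm of $\mathbb{X}^*$), and $\mathcal{D}(\mathbb{X})=\sup\{D(x):x\in\mathbb{X}\setminus\{0\}\}$. *)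

(* Defs.v *)
From HB Require Import structures.
From mathcomp Require Import all_boot all_order all_algebra.
From mathcomp Require Import complex.
From mathcomp Require Import all_classical all_reals all_analysis.

Set Implicit Arguments.
Unset Strict Implicit.
Unset Printing Implicit Defensive.
Import Order.TTheory GRing.Theory Num.Theory.
Import numFieldTopology.Exports numFieldNormedType.Exports.
Local Open Scope classical_set_scope.
Local Open Scope ring_scope.

Variant scalar_kind := real_scalars | complex_scalars.

Definition scalars (R : realType) (k : scalar_kind) : numFieldType :=
  match k with
  | real_scalars => R
  | complex_scalars => R[i]
  end.

Definition to_real (R : realType) (k : scalar_kind) : scalars R k -> R :=
  match k with
  | real_scalars => fun a : R => a
  | complex_scalars => fun a : R[i] => complex.Re a
  end.

Definition of_real (R : realType) (k : scalar_kind) : R -> scalars R k :=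
  match k with
  | real_scalars => fun a : R => a
  | complex_scalars => fun a : R => (a +i* 0)%C
  end.

(* to_real and of_real move K-valued norms to R and back: a nonnegative element
   of R[i] has zero imaginary part (to_realK below). *)
Arguments to_real {R k}.
Arguments of_real {R} k.

Section scalars_theory.
Variables (R : realType) (k : scalar_kind).
Local Notation K := (scalars R k).

Lemma of_realK : cancel (of_real k) (@to_real R k).
Proof. by case: k. Qed.

Lemma to_realK (a : K) : 0 <= a -> of_real k (to_real a) = a.
Proof.
case: k a => //= -[a b]; rewrite lecE /= => /andP[/eqP -> _].
by [].
Qed.

Lemma to_real_ge0 (a : K) : 0 <= a -> 0 <= to_real a.
Proof. by case: k a => //= -[a b]; rewrite lecE /= => /andP[]. Qed.

Lemma to_real_le (a b : K) : a <= b -> to_real a <= to_real b.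
Proof. by case: k a b => //= -[a b] [c d]; rewrite lecE /= => /andP[]. Qed.

Lemma of_real_le (a b : R) : a <= b -> of_real k a <= of_real k b.
Proof. by case: k => //= ab; rewrite lecE /= eqxx. Qed.

Lemma of_realD (a b : R) : of_real k (a + b) = of_real k a + of_real k b.
Proof. by case: k => //=; apply/eqP; rewrite eq_complex /= addr0 !eqxx. Qed.

Lemma of_realM (a b : R) : of_real k (a * b) = of_real k a * of_real k b.
Proof.
case: k => //=; apply/eqP.
by rewrite eq_complex /= !mulr0 !mul0r subr0 addr0 !eqxx.
Qed.

Lemma of_real0 : @of_real R k 0 = 0.
Proof. by case: k. Qed.

Lemma of_real_inj : injective (@of_real R k).
Proof. exact: can_inj of_realK. Qed.

End scalars_theory.

(* The library's norm on a normed module over K takes its values in K;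
   rnorm is the same number seen in R. *)
Definition rnorm (R : realType) (k : scalar_kind)
  (V : normedModType (scalars R k)) (x : V) : R := to_real `|x|.

Section rnorm_theory.
Variables (R : realType) (k : scalar_kind) (V : normedModType (scalars R k)).
Implicit Types x y : V.

Lemma rnormE x : of_real k (rnorm x) = `|x|.
Proof. by rewrite /rnorm to_realK. Qed.

Lemma rnorm_ge0 x : 0 <= rnorm x.
Proof. exact: to_real_ge0. Qed.

Lemma rnormD x y : rnorm (x + y) <= rnorm x + rnorm y.
Proof.
rewrite -[leRHS](@of_realK R k) of_realD !rnormE.
by apply: to_real_le; exact: ler_normD.
Qed.

Lemma rnormZ (a : scalars R k) x : rnorm (a *: x) = to_real `|a| * rnorm x.
Proof.
by apply: (@of_real_inj R k); rewrite of_realM rnormE to_realK// rnormE normrZ.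
Qed.

Lemma rnorm0 : rnorm (0 : V) = 0.
Proof. by apply: (@of_real_inj R k); rewrite rnormE normr0 of_real0. Qed.

Lemma rnorm_eq0 x : rnorm x = 0 -> x = 0.
Proof. by move=> x0; apply/normr0_eq0; rewrite -rnormE x0 of_real0. Qed.

End rnorm_theory.

Section support_functionals.
Variables (R : realType) (k : scalar_kind) (V : normedModType (scalars R k)).
Local Notation K := (scalars R k).
Local Open Scope ereal_scope.

(* Suprema are taken in \bar R, so an unbounded set gets +oo and an empty one
   -oo. For x != 0 the set J x is nonempty by Hahn-Banach, and the index set of
   calD is empty only when V is the zero space, where calD V = -oo. *)
Definition opnorm (f : V -> K^o) : \bar R :=
  ereal_sup [set (rnorm (f x))%:E | x in [set x : V | (rnorm x <= 1)%R]].

Definition J (x : V) : set {linear V -> K^o} :=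
  [set f : {linear V -> K^o} |
    [/\ continuous (f : V -> K^o), opnorm f = 1 & f x = `|x|%R]].

Definition D (x : V) : \bar R :=
  ereal_sup [set opnorm (fun y => f y - g y)%R | f in J x & g in J x].

End support_functionals.

Arguments J {R k V}.
Arguments D {R k V}.

Definition calD (R : realType) (k : scalar_kind)
    (V : normedModType (scalars R k)) : \bar R :=
  ereal_sup [set D x | x in [set x : V | x != 0]].
Arguments calD {R k}.

Section lp_sum.
Variables (R : realType) (k : scalar_kind).
Variable X : nat -> normedModType (scalars R k).
Local Notation K := (scalars R k).

Definition psum (p : R) (x : forall n, X n) : \bar R :=
  (\sum_(0 <= n <oo) (rnorm (x n) `^ p)%:E)%E.

(* The bound 1 <= p is a parameter of the type since it is needed for the
   vector space structure and the norm below. *)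
Record lpsum (p : R) (p1 : 1 <= p) := LpSum {
  lpsum_seq :> forall n, X n;
  lpsum_fin : (psum p lpsum_seq < +oo)%E }.

Section fixed_exponent.
Variables (p : R) (p1 : 1 <= p).
Local Notation T := (lpsum p1).
Let p0 : 0 < p. Proof. exact: lt_le_trans p1. Qed.

Lemma lpsum_eqP (x y : T) : (forall n, x n = y n) -> x = y.
Proof.
case: x y => x hx [y hy] /= xy.
have e : x = y by exact: functional_extensionality_dep.
by case: _ / e hy => hy; congr LpSum; exact: Prop_irrelevance.
Qed.

Lemma psum_ge0 (x : forall n, X n) : (0 <= psum p x)%E.
Proof. by apply: nneseries_ge0 => n _ _; rewrite lee_fin powR_ge0. Qed.

Definition lpnorm (x : forall n, X n) : R := fine (psum p x) `^ p^-1.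

Let Npsum (x : forall n, X n) :
  Lnorm counting p%:E (EFin \o (fun n => rnorm (x n))) = (psum p x `^ p^-1)%E.
Proof.
rewrite Lnorm_counting//; congr (_ `^ _)%E; apply: eq_eseriesr => n _ /=.
by rewrite ger0_norm ?rnorm_ge0.
Qed.

Lemma psum_poweR (x : forall n, X n) : (psum p x < +oo)%E ->
  (psum p x `^ p^-1)%E = (lpnorm x)%:E.
Proof.
move=> hx; rewrite /lpnorm -poweR_EFin fineK// ge0_fin_numE//.
exact: psum_ge0.
Qed.

Let psum_powD (x y : forall n, X n) :
  (psum p (fun n => x n + y n)%R `^ p^-1 <=
   psum p x `^ p^-1 + psum p y `^ p^-1)%E.
Proof.
rewrite -!Npsum.
have := @minkowski_EFin _ _ R counting (fun n => rnorm (x n))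
  (fun n => rnorm (y n)) p.
move=> /(_ _ _ p1) M.
apply: le_trans (M _ _) => //.
rewrite !Lnorm_counting//; apply: gt0_ler_poweR.
- by rewrite invr_ge0 ltW.
- by rewrite in_itv/= leey andbT nneseries_ge0.
- by rewrite in_itv/= leey andbT nneseries_ge0.
apply: lee_nneseries => n _ //=.
rewrite lee_fin ge0_ler_powR ?nnegrE ?normr_ge0 ?(ltW p0)//.
by rewrite !ger0_norm ?addr_ge0 ?rnorm_ge0 ?rnormD.
Qed.

Let psum_lty (x : forall n, X n) : (psum p x `^ p^-1 < +oo)%E ->
  (psum p x < +oo)%E.
Proof.
by apply: lty_poweRy; rewrite invr_eq0 gt_eqF.
Qed.

Lemma lpsumD_fin (x y : T) : (psum p (fun n => x n + y n)%R < +oo)%E.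
Proof.
apply: psum_lty; apply: le_lt_trans (psum_powD _ _) _.
by rewrite !psum_poweR ?lpsum_fin// -EFinD ltry.
Qed.

Lemma psumZ (a : K) (x : forall n, X n) :
  psum p (fun n => a *: x n) = ((to_real `|a| `^ p)%:E * psum p x)%E.
Proof.
rewrite /psum -nneseriesZl; last by move=> n _; rewrite lee_fin powR_ge0.
apply: eq_eseriesr => n _.
by rewrite rnormZ powRM ?rnorm_ge0 ?to_real_ge0.
Qed.

Lemma lpsumZ_fin (a : K) (x : T) : (psum p (fun n => a *: x n)%R < +oo)%E.
Proof.
by rewrite psumZ lte_mul_pinfty ?lee_fin ?powR_ge0// lpsum_fin.
Qed.

Lemma lpsum0_fin : (psum p (fun n => 0%R : X n) < +oo)%E.
Proof.
by rewrite /psum eseries0// => n _ _; rewrite rnorm0 powR0// gt_eqF.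
Qed.

Lemma lpsumN_fin (x : T) : (psum p (fun n => (- x n)%R) < +oo)%E.
Proof.
have := lpsumZ_fin (-1) x; congr (_ < _)%E; apply: eq_eseriesr => n _.
by rewrite scaleN1r.
Qed.

HB.instance Definition _ := gen_eqMixin T.
HB.instance Definition _ := gen_choiceMixin T.

Definition lpsum_add (x y : T) : T := LpSum p1 (lpsumD_fin x y).
Definition lpsum_opp (x : T) : T := LpSum p1 (lpsumN_fin x).
Definition lpsum_scale (a : K) (x : T) : T := LpSum p1 (lpsumZ_fin a x).
Definition lpsum_zero : T := LpSum p1 lpsum0_fin.

Let addA : associative lpsum_add.
Proof. by move=> x y z; apply: lpsum_eqP => n /=; rewrite addrA. Qed.
Let addC : commutative lpsum_add.
Proof. by move=> x y; apply: lpsum_eqP => n /=; rewrite addrC. Qed.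
Let add0 : left_id lpsum_zero lpsum_add.
Proof. by move=> x; apply: lpsum_eqP => n /=; rewrite add0r. Qed.
Let addN : left_inverse lpsum_zero lpsum_opp lpsum_add.
Proof. by move=> x; apply: lpsum_eqP => n /=; rewrite addNr. Qed.

HB.instance Definition _ := GRing.isZmodule.Build T addA addC add0 addN.

Let scaleA (a b : K) (x : T) :
  lpsum_scale a (lpsum_scale b x) = lpsum_scale (a * b) x.
Proof. by apply: lpsum_eqP => n /=; rewrite scalerA. Qed.
Let scale1 : left_id 1 lpsum_scale.
Proof. by move=> x; apply: lpsum_eqP => n /=; rewrite scale1r. Qed.
Let scaleDr : right_distributive lpsum_scale +%R.
Proof. by move=> a x y; apply: lpsum_eqP => n /=; rewrite scalerDr. Qed.
Let scaleDl (x : T) : {morph lpsum_scale^~ x : a b / a + b}.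
Proof. by move=> a b; apply: lpsum_eqP => n /=; rewrite scalerDl. Qed.

HB.instance Definition _ :=
  GRing.Zmodule_isLmodule.Build K T scaleA scale1 scaleDr scaleDl.

Definition lpsum_norm (x : T) : K := of_real k (lpnorm x).

Let lpnormD (x y : T) :
  lpsum_norm (x + y) <= lpsum_norm x + lpsum_norm y.
Proof.
rewrite /lpsum_norm -of_realD; apply: of_real_le.
have M := psum_powD x y.
rewrite (psum_poweR (lpsum_fin x)) (psum_poweR (lpsum_fin y)) in M.
by rewrite (psum_poweR (lpsumD_fin x y)) -EFinD lee_fin in M.
Qed.

Let lpnormZ (a : K) (x : T) : lpsum_norm (a *: x) = `|a| * lpsum_norm x.
Proof.
rewrite /lpsum_norm -[X in X * _]to_realK// -of_realM; congr (of_real k _).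
rewrite /lpnorm psumZ fineM//; last first.
  by rewrite ge0_fin_numE ?psum_ge0// lpsum_fin.
rewrite powRM ?powR_ge0 ?fine_ge0 ?psum_ge0//.
by rewrite -powRrM mulfV ?gt_eqF// powRr1// to_real_ge0.
Qed.

Let lpnorm_eq0 (x : T) : lpsum_norm x = 0 -> x = 0.
Proof.
rewrite /lpsum_norm -(of_real0 R k) => /(@of_real_inj R k) /powR_eq0_eq0 x0.
have {}x0 : psum p x = 0%E.
  by rewrite -[LHS]fineK ?x0// ge0_fin_numE ?psum_ge0// lpsum_fin.
apply: lpsum_eqP => n /=; apply: rnorm_eq0.
have h i : (0 <= (rnorm (x i) `^ p)%:E :> \bar R)%E by rewrite lee_fin powR_ge0.
have : ((rnorm (x n) `^ p)%:E <= psum p x)%E.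
  rewrite /psum (@nneseriesD1 _ (fun i => (rnorm (x i) `^ p)%:E) n predT)//.
  by rewrite leeDl// nneseries_ge0.
rewrite x0 lee_fin => xn0; apply: (@powR_eq0_eq0 _ _ p).
by apply/eqP; rewrite eq_le xn0 powR_ge0.
Qed.

HB.instance Definition _ :=
  Lmodule_isNormed.Build K T lpnormD lpnormZ lpnorm_eq0.

Lemma lpsum_rnormE (x : T) : rnorm x = lpnorm x.
Proof. exact: of_realK. Qed.

End fixed_exponent.
End lp_sum.

(* Main.v *)
(* Let x have norm 1 in the p-sum and let f support x. Comparing f with the norm
   along the lines x + t y, for y supported in one coordinate n or vanishing
   there, determines the size of the restriction f_n of f to X_n: it has norm at
   most |x_n|^(p-1) and f_n(x_n) = |x_n|^p. Hence f_n / |x_n|^(p-1) supports x_n,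
   and two support functionals f, g of x satisfy
     |f_n - g_n| <= |x_n|^(p-1) calD(X_n).
   By Young's inequality |f - g| <= 2 (1 - gap), where gap > 0 comes from a single
   coordinate with x_n != 0 and does not depend on f and g. Conversely each X_n
   embeds isometrically and its support functionals extend along the coordinate
   projection, so calD of the sum is at least every 2 - 1/(n+1). *)
Require Import Defs.
From HB Require Import structures.
From mathcomp Require Import all_boot all_order all_algebra.
From mathcomp Require Import complex ring lra.
From mathcomp Require Import all_classical all_reals all_analysis.

Set Implicit Arguments.
Unset Strict Implicit.
Unset Printing Implicit Defensive.
Import Order.TTheory GRing.Theory Num.Theory.
Import numFieldTopology.Exports numFieldNormedType.Exports.
Local Open Scope ring_scope.

(** * Convexity and continuity inequalities for real powers *)

Section real_powers.
Variable R : realType.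
Implicit Types a b p r s z : R.

Lemma powRS a p : 0 <= a -> 0 < p -> a `^ p = a * a `^ (p - 1).
Proof.
rewrite le_eqVlt => /predU1P[<- p0|a0 p0]; first by rewrite mul0r powR0 ?gt_eqF.
rewrite -[X in X * _]powRr1 ?ltW// -powRD ?(gt_eqF a0) ?implybT//.
by congr (_ `^ _); ring.
Qed.

Lemma powR_le1 a p : 0 < p -> 0 <= a -> a <= 1 -> a `^ p <= 1.
Proof.
move=> p0 a0 a1; have := @ge0_ler_powR R p (ltW p0) a 1.
by rewrite powR1 !nnegrE; apply.
Qed.

Lemma powR_lt1 a p : 0 < p -> 0 <= a -> a < 1 -> a `^ p < 1.
Proof.
move=> p0 a0 a1; have := @gt0_ltr_powR R p p0 a 1.
by rewrite powR1 !nnegrE; apply.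
Qed.

(* The tangent inequality of the convex function powR^~ p at a, multiplied out;
   Young's inequality for a^(p-1) and b. *)
Lemma powR_gradient a b p : 1 < p -> 0 <= a -> 0 <= b ->
  p * (a `^ (p - 1) * b) <= (p - 1) * a `^ p + b `^ p.
Proof.
move=> p1 a0 b0; have p0 : 0 < p by lra.
have p10 : 0 < p - 1 by lra.
have := @conjugate_powR R (a `^ (p - 1)) b (p / (p - 1)) p.
move=> /(_ (powR_ge0 _ _) b0 (divr_gt0 p0 p10) p0).
have -> : (p / (p - 1))^-1 + p^-1 = 1.
  by field; rewrite !gt_eqF.
move=> /(_ erefl); rewrite -powRrM.
have -> : (p - 1) * (p / (p - 1)) = p by field; rewrite gt_eqF.
move=> H; rewrite -(ler_pM2l p0) in H.
apply: le_trans H _; rewrite le_eqVlt; apply/orP; left; apply/eqP.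
by field; rewrite !gt_eqF.
Qed.

(** Tangent of the power function at 1. *)
Lemma powR_bernoulli b p : 1 < p -> 0 <= b -> 1 + p * (b - 1) <= b `^ p.
Proof.
by move=> p1 b0; have := powR_gradient p1 ler01 b0; rewrite !powR1; lra.
Qed.

(** Right continuity at [t = 0], made explicit: if z > s^a r, the root b = (z/r)^(1/a) exceeds [s],
    and the [t] for which s + t r is the midpoint of [s] and b contradicts the hypothesis. *)
Lemma powR_right_limit s r a z : 0 <= s -> 0 <= r -> 0 < a ->
  (forall t, 0 < t -> z <= (s + t * r) `^ a * r) -> z <= s `^ a * r.
Proof.
move=> s0; rewrite le_eqVlt => /predU1P[<- a0 H|r0 a0 H].
  by move: (H 1 ltr01); rewrite !mulr0.
rewrite leNgt; apply/negP; rewrite -ltr_pdivlMr// => sz.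
have zE : ((z / r) `^ a^-1) `^ a = z / r.
  rewrite -powRrM mulVf ?gt_eqF// powRr1//.
  exact: le_trans (powR_ge0 s a) (ltW sz).
set b := (z / r) `^ a^-1 in zE.
have b0 : 0 <= b by exact: powR_ge0.
have sb : s < b.
  rewrite ltNge; apply/negP => bs.
  by have := ge0_ler_powR (ltW a0) b0 s0 bs; rewrite zE leNgt sz.
have e0 : 0 < (b - s) / 2 by lra.
have := H _ (divr_gt0 e0 r0); rewrite divfK ?gt_eqF// leNgt => /negP; apply.
rewrite -ltr_pdivlMr// -zE gt0_ltr_powR ?nnegrE//; lra.
Qed.

(** With A = s + t r, Bernoulli gives 1 + p t c <= b^p, and the tangent at A, compared with [s],
    gives A^p - s^p <= p A^(p-1) t r. Chaining the two through the hypothesis on b^p and cancelling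
    p t leaves the claim. *)
Lemma powR_secant s r t p b c : 1 < p -> 0 <= s -> 0 <= r -> 0 < t -> 0 <= b ->
  1 + t * c <= b -> b `^ p <= 1 - s `^ p + (s + t * r) `^ p ->
  c <= (s + t * r) `^ (p - 1) * r.
Proof.
move=> p1 s0 r0 t0 b0 cb bp.
have p0 : 0 < p by lra.
have A0 : 0 <= s + t * r by rewrite addr_ge0// mulr_ge0// ltW.
have B := powR_bernoulli p1 b0.
have G := powR_gradient p1 A0 s0.
have E := powRS A0 p0.
rewrite -(ler_pM2l (mulr_gt0 p0 t0)) -!mulrA.
have : p * (t * c) <= p * (b - 1) by rewrite ler_pM2l//; lra.
by move: B G bp; rewrite E; move: (_ `^ (p - 1)) (s `^ p) (b `^ p) => u v w; nra.
Qed.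

End real_powers.

(** * Scalars, operator norms and support functionals *)

Section support_functionals.
Variables (R : realType) (k : scalar_kind).
Local Notation K := (scalars R k).

Lemma to_realD (a b : K) : to_real (a + b) = to_real a + to_real b.
Proof. by case: k a b => //= -[a1 a2] []. Qed.

Lemma to_realB (a b : K) : to_real (a - b) = to_real a - to_real b.
Proof. by case: k a b => //= -[a1 a2] []. Qed.

Lemma to_realZ (r : R) (a : K) : to_real (of_real k r * a) = r * to_real a.
Proof. by case: k a => //= -[a1 a2] /=; rewrite mul0r subr0. Qed.

Lemma of_real1 : of_real k (1 : R) = 1.
Proof. by case: k. Qed.

Lemma to_real1 : to_real (1 : K) = 1 :> R.
Proof. by rewrite -of_real1 of_realK. Qed.

Lemma norm_of_real (r : R) : 0 <= r -> `|of_real k r| = of_real k r.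
Proof. by move=> r0; rewrite ger0_norm// -(of_real0 R k) of_real_le. Qed.

Lemma to_real_le_norm (a : K) : to_real a <= to_real `|a|.
Proof.
case: k a => [a|[a b]]; first exact: ler_norm.
rewrite /= (le_trans (ler_norm a))// -sqrtr_sqr ler_wsqrtr//.
by rewrite lerDl sqr_ge0.
Qed.

(** In the complex case |a|^2 = Re(a)^2 + Im(a)^2, so the hypothesis leaves no room for an imaginary
    part. It turns bounds on real parts into an exact value of a functional. *)
Lemma to_real_norm_eq (a : K) : to_real `|a| <= to_real a -> a = of_real k (to_real a).
Proof.
case: k a => [//|[a b]] /= H; have a0 : 0 <= a by apply: le_trans H; exact: sqrtr_ge0.
have : a ^+ 2 + b ^+ 2 <= a ^+ 2.
  rewrite -[leLHS]sqr_sqrtr ?addr_ge0 ?sqr_ge0//.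
  by rewrite ler_pXn2r ?nnegrE ?sqrtr_ge0.
by rewrite gerDl le_eqVlt ltNge sqr_ge0 orbF sqrf_eq0 => /eqP ->.
Qed.

Variable V : normedModType K.
Implicit Types (x y v : V) (f g : {linear V -> K^o}) (c r : R).

Lemma rnorm_gt0 x : x != 0 -> 0 < rnorm x.
Proof.
move=> x0; rewrite lt_neqAle rnorm_ge0 eq_sym andbT.
by apply: contra_neq x0; exact: rnorm_eq0.
Qed.

Lemma rnormZr (W : normedModType K) (x : W) c : 0 <= c ->
  rnorm (of_real k c *: x) = c * rnorm x.
Proof. by move=> c0; rewrite rnormZ norm_of_real// of_realK. Qed.

Lemma rnormKE (a : K^o) : rnorm a = to_real `|a : K|.
Proof. by []. Qed.

Lemma rnorm_of_real c : 0 <= c -> rnorm (of_real k c : K^o) = c.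
Proof. by move=> c0; rewrite rnormKE norm_of_real// of_realK. Qed.

Lemma rnorm_linZ f c y : 0 <= c ->
  rnorm (f (of_real k c *: y)) = c * rnorm (f y).
Proof. by move=> c0; rewrite linearZ; exact: (@rnormZr K^o). Qed.

Lemma opnorm_le (h : V -> K^o) c : 0 <= c ->
  (forall y, rnorm (h y) <= c * rnorm y) -> (opnorm h <= c%:E)%E.
Proof.
move=> c0 H; apply: ge_ereal_sup => _ [y /= y1 <-]; rewrite lee_fin.
by rewrite (le_trans (H y))// ler_piMr.
Qed.

Lemma opnorm_bound (h : {linear V -> K^o}) c y : (opnorm h <= c%:E)%E ->
  rnorm (h y) <= c * rnorm y.
Proof.
move=> H; have [->|y0] := eqVneq y 0; first by rewrite linear0 !rnorm0 mulr0.
have ny := rnorm_gt0 y0.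
have : (rnorm (h (of_real k (rnorm y)^-1 *: y)) <= c).
  rewrite -lee_fin; apply: le_trans H; apply: ereal_sup_ubound => /=.
  exists (of_real k (rnorm y)^-1 *: y) => //=.
  by rewrite rnormZr ?invr_ge0 ?rnorm_ge0// mulVf// gt_eqF.
by rewrite rnorm_linZ ?invr_ge0 ?rnorm_ge0// mulrC ler_pdivrMr.
Qed.

Lemma J_bound x f y : J x f -> rnorm (f y) <= rnorm y.
Proof. by case=> _ f1 _; rewrite -[leRHS]mul1r opnorm_bound// f1. Qed.

Lemma J_apply x f : J x f -> f x = of_real k (rnorm x).
Proof. by case=> _ _ ->; rewrite rnormE. Qed.

Lemma linear_continuous_of_bound f c : 0 <= c ->
  (forall y, rnorm (f y) <= c * rnorm y) -> continuous (f : V -> K^o).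
Proof.
move=> c0 H; apply: bounded_linear_continuous; apply/linear_boundedP.
exists (of_real k c); split.
  by apply: ger0_real; rewrite -(of_real0 R k) of_real_le.
move=> r cr x; apply: (@le_trans _ _ (of_real k c * `|x|)).
  2: by rewrite ler_wpM2r// ltW.
by rewrite -rnormE -[in leRHS]rnormE -of_realM of_real_le.
Qed.

(** The bound gives continuity and operator norm at most 1; the unit vector x/|x| attains 1. *)
Lemma mem_J x f : x != 0 -> (forall y, rnorm (f y) <= rnorm y) ->
  f x = of_real k (rnorm x) -> J x f.
Proof.
move=> x0 H fx; split; last by rewrite fx rnormE.
- by apply: (@linear_continuous_of_bound _ 1) => // y; rewrite mul1r.
- apply/eqP; rewrite eq_le opnorm_le//=; last by move=> y; rewrite mul1r.
  have nx := rnorm_gt0 x0.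
  apply: ereal_sup_ubound; exists (of_real k (rnorm x)^-1 *: x) => /=.
    by rewrite rnormZr ?invr_ge0 ?rnorm_ge0// mulVf// gt_eqF.
  rewrite rnorm_linZ ?invr_ge0 ?rnorm_ge0// fx rnorm_of_real ?rnorm_ge0//.
  by rewrite mulVf// gt_eqF.
Qed.

Lemma J_diff_bound x f g c y : x != 0 -> (calD V <= c%:E)%E -> J x f -> J x g ->
  rnorm (f y - g y) <= c * rnorm y.
Proof.
move=> x0 Dc Jf Jg; apply: (@opnorm_bound (f \- g)).
apply: le_trans Dc; apply: (@le_trans _ _ (D x)).
  by apply: ereal_sup_ubound => /=; exists f => //; exists g.
by apply: ereal_sup_ubound; exists x.
Qed.

Lemma J_scale x f c : 0 < c -> J x f -> J (of_real k c *: x) f.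
Proof.
move=> c0 [fc f1 fx]; split=> //.
by rewrite linearZ/= fx normrZ norm_of_real// ltW.
Qed.

(** A positive multiple of [x] keeps every support functional of [x], which allows normalizing [x]
    later. *)
Lemma D_scale x c : 0 < c -> (D x <= D (of_real k c *: x)%R)%E.
Proof.
move=> c0; apply: le_ereal_sup => _ [f Jf [g Jg <-]].
by exists f; [exact: J_scale|exists g => //; exact: J_scale].
Qed.

End support_functionals.

(** * Coordinates, embeddings and truncations in the p-sum *)

Section lp_sum_coordinates.
Variables (R : realType) (k : scalar_kind).
Variable X : nat -> normedModType (scalars R k).
Variables (p : R) (hp : 1 < p).
Local Notation K := (scalars R k).
Local Notation T := (lpsum X (ltW hp)).
Implicit Types (x y z : T) (n m : nat).

Let p0 : 0 < p. Proof. exact: lt_trans hp. Qed.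

Let term_ge0 (x : forall n, X n) i : (0 <= (rnorm (x i) `^ p)%:E :> \bar R)%E.
Proof. by rewrite lee_fin powR_ge0. Qed.

Lemma rnorm_lpsum_powR x : (rnorm x `^ p)%:E = psum p x.
Proof.
rewrite lpsum_rnormE /lpnorm -powRrM mulVf ?gt_eqF//.
rewrite powRr1 ?fine_ge0 ?psum_ge0// fineK// ge0_fin_numE ?psum_ge0//.
exact: lpsum_fin.
Qed.

Lemma psum_split n (x : forall n, X n) :
  psum p x = ((rnorm (x n) `^ p)%:E +
    \sum_(0 <= i <oo | i != n) (rnorm (x i) `^ p)%:E)%E.
Proof. by rewrite /psum (@nneseriesD1 _ _ n predT). Qed.

Lemma psum_single_fin n (v : X n) :
  (psum p (dfwith (fun i => 0%R : X i) n v) < +oo)%E.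
Proof.
rewrite (psum_split n) eseries0; first by rewrite adde0 ltry.
by move=> i _ /= ni; rewrite dfwithout 1?eq_sym// rnorm0 powR0// gt_eqF.
Qed.

Definition single n (v : X n) : T := LpSum (ltW hp) (psum_single_fin v).

(** Named so that the projection can carry a linear structure and be composed with functionals. *)
Definition coordinate n (x : T) : X n := x n.

Lemma singleE n (v : X n) : single v n = v.
Proof. exact: dfwithin. Qed.

Lemma single_out n (v : X n) i : i != n -> single v i = 0.
Proof. by move=> ni; rewrite /single /= dfwithout// eq_sym. Qed.

Lemma lpsumDE x y n : (x + y) n = x n + y n. Proof. by []. Qed.
Lemma lpsumNE x n : (- x) n = - x n. Proof. by []. Qed.
Lemma lpsumZE (a : K) x n : (a *: x) n = a *: x n. Proof. by []. Qed.
Lemma lpsum0E n : (0 : T) n = 0. Proof. by []. Qed.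

Lemma coordinate_is_linear n : linear (@coordinate n).
Proof. by []. Qed.

HB.instance Definition _ n :=
  GRing.isLinear.Build K T (X n) _ (@coordinate n) (@coordinate_is_linear n).

Lemma single_is_linear n : linear (@single n).
Proof.
move=> a u v; apply: lpsum_eqP => i; rewrite lpsumDE lpsumZE.
have [->|ni] := eqVneq i n; first by rewrite !singleE.
by rewrite !single_out// scaler0 addr0.
Qed.

HB.instance Definition _ n :=
  GRing.isLinear.Build K (X n) T _ (@single n) (@single_is_linear n).

(** The remainder [r] must be finite because the left-hand sides are, so it cancels. *)
Let EFin_split (a b c d : R) (r : \bar R) :
  a%:E = (b%:E + r)%E -> c%:E = (d%:E + r)%E -> a - b = c - d.
Proof. by case: r => [r| |]//= [->] [->]; rewrite !(addrC _ r) !addrK. Qed.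

(** Both sides equal the series over the indices other than [n]. Norms of vectors changed in one
    coordinate are computed from this without returning to series. *)
Lemma rnorm_lpsum_swap n x y : (forall i, i != n -> x i = y i) ->
  rnorm x `^ p - rnorm (x n) `^ p = rnorm y `^ p - rnorm (y n) `^ p.
Proof.
move=> xy; apply: EFin_split.
  by rewrite rnorm_lpsum_powR; exact: psum_split.
rewrite rnorm_lpsum_powR (psum_split n); congr (_ + _)%E.
by apply: eq_eseriesr => i /xy ->.
Qed.

Lemma rnorm_single n (v : X n) : rnorm (single v) = rnorm v.
Proof.
have := @rnorm_lpsum_swap n (single v) 0; rewrite singleE lpsum0E !rnorm0 subrr.
move=> /(_ (@single_out n v)) /eqP; rewrite subr_eq0 => /eqP.
by apply: powR_injective; rewrite ?nnegrE ?rnorm_ge0.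
Qed.

Definition truncation m x : T := \sum_(i < m) single (x i).

Lemma truncationE m x j : truncation m x j = if (j < m)%N then x j else 0.
Proof.
rewrite /truncation; elim: m => [|m IH]; first by rewrite big_ord0.
rewrite big_ord_recr lpsumDE IH ltnS (leq_eqVlt j).
have [->|jm] := eqVneq j m; first by rewrite singleE ltnn add0r.
by rewrite single_out// addr0.
Qed.

Lemma truncation_tailE m x j :
  (x - truncation m x) j = if (j < m)%N then 0 else x j.
Proof.
by rewrite lpsumDE lpsumNE truncationE; case: ifP => _; rewrite ?subrr ?subr0.
Qed.

Let sub_step (a b c d e t : R) : a - e = b - d -> e = 0 -> b = c - t ->
  a = c - (t + d).
Proof. by lra. Qed.

(** Induction on [m]: the tails at [m] and [m.+1] differ only in coordinate [m], where the new one
    vanishes. *)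
Lemma rnorm_truncation_tail m x :
  rnorm (x - truncation m x) `^ p =
  rnorm x `^ p - \sum_(i < m) rnorm (x i) `^ p.
Proof.
elim: m => [|m IH]; first by rewrite /truncation !big_ord0 !subr0.
have agree i : i != m -> (x - truncation m.+1 x) i = (x - truncation m x) i.
  by move=> im; rewrite !truncation_tailE ltnS (leq_eqVlt i) (negbTE im).
rewrite big_ord_recr; apply: (sub_step _ _ IH).
  have -> : rnorm (x m) = rnorm ((x - truncation m x) m).
    by rewrite truncation_tailE ltnn.
  exact: rnorm_lpsum_swap agree.
by rewrite truncation_tailE ltnSn rnorm0 powR0 ?gt_eqF.
Qed.

Lemma sum_coordinates_le x m : \sum_(i < m) rnorm (x i) `^ p <= rnorm x `^ p.
Proof. by rewrite -subr_ge0 -rnorm_truncation_tail powR_ge0. Qed.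

Lemma rnorm_coordinate_le n x : rnorm (x n) <= rnorm x.
Proof.
have : rnorm (x n) `^ p <= rnorm x `^ p.
  apply: le_trans (sum_coordinates_le x n.+1); rewrite big_ord_recr/= lerDr.
  by apply: sumr_ge0 => i _; exact: powR_ge0.
by rewrite leNgt; apply: contraNle => H; rewrite gt0_ltr_powR ?nnegrE ?rnorm_ge0.
Qed.

(** The p-th power of the tail norm is |x|^p minus a partial sum, and the partial sums converge to
    |x|^p. *)
Lemma truncation_near x (e : R) : 0 < e ->
  (\forall m \near \oo, (rnorm (x - truncation m x) <= e)%R)%classic.
Proof.
move=> e0; have ep0 : 0 < e `^ p by exact: powR_gt0.
pose S m := \sum_(i < m) rnorm (x i) `^ p.
have /fine_cvgP[_ Scvg] : ((S m)%:E @[m --> \oo] --> (rnorm x `^ p)%:E)%classic.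
  rewrite rnorm_lpsum_powR.
  under eq_fun => m do rewrite /S -sumEFin
    -(big_mkord xpredT (fun i => (rnorm (x i) `^ p)%:E)).
  by apply: is_cvg_nneseries.
have Sgt : rnorm x `^ p - e `^ p < rnorm x `^ p by rewrite ltrBlDr ltrDl.
apply: filterS (cvgr_gt _ Scvg _ Sgt) => m /= Sm.
rewrite leNgt; apply/negP => /(gt0_ltr_powR p0).
rewrite !nnegrE rnorm_ge0 ltW// => /(_ isT isT).
by rewrite rnorm_truncation_tail ltrBrDr -ltrBrDl ltNge ltW.
Qed.

End lp_sum_coordinates.

(** * Restrictions of support functionals to coordinates *)

Section lp_sum_support.
Variables (R : realType) (k : scalar_kind).
Variable X : nat -> normedModType (scalars R k).
Variables (p : R) (hp : 1 < p).
Local Notation K := (scalars R k).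
Local Notation T := (lpsum X (ltW hp)).
Local Notation single_lin n := (@single _ _ _ _ hp n).
Local Notation single := (single hp).
Implicit Types (x y z : T) (n m : nat) (f g : {linear T -> K^o}) (r s : R).

Let p0 : 0 < p. Proof. exact: lt_trans hp. Qed.
Let pB0 : 0 < p - 1. Proof. by rewrite subr_gt0. Qed.

(* The hypothesis compares ||x + t y||^p with a function of t having the same
   value at t = 0 and right derivative p s^(p-1) r. *)
Lemma support_derivative x f y s r : f x = 1 ->
  (forall z, rnorm (f z) <= rnorm z) -> 0 <= s -> 0 <= r ->
  (forall t, 0 < t ->
    rnorm (x + of_real k t *: y) `^ p <= 1 - s `^ p + (s + t * r) `^ p) ->
  to_real (f y) <= s `^ (p - 1) * r.
Proof.
move=> fx fb s0 r0 H; apply: powR_right_limit => // t t0.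
apply: (@powR_secant _ _ _ _ _ (rnorm (x + of_real k t *: y))); rewrite ?rnorm_ge0//.
  (* 1 + t Re f(y) is the real part of f(x + t y), hence at most |x + t y|. *)
  apply: le_trans (fb _); rewrite linearD linearZ/= fx.
  apply: le_trans (to_real_le_norm _).
  by rewrite to_realD to_realZ to_real1.
exact: H.
Qed.

Let shift_le (a b c d : R) : b <= d -> a - b = 1 - c -> a <= 1 - c + d.
Proof. by lra. Qed.

(** Rotating [v] by the unimodular scalar [u] makes f(u v) equal to |f(v)|. Moving [x] along u v
    alters only coordinate [n], whose norm becomes at most |x_n| + t |v|, so the derivative bound
    applies with s = |x_n| and r = |v|. *)
Lemma support_single_le x f n (v : X n) : rnorm x = 1 -> f x = 1 ->
  (forall z, rnorm (f z) <= rnorm z) ->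
  rnorm (f (single v)) <= rnorm (x n) `^ (p - 1) * rnorm v.
Proof.
move=> x1 fx fb; set a : K := f (single v).
have [->|a0] := eqVneq a 0.
  by rewrite rnorm0 mulr_ge0 ?powR_ge0 ?rnorm_ge0.
pose u := `|a| / a.
have u1 : `|u| = 1 by rewrite normrM normfV normr_id mulfV// normr_eq0.
have fu : f (single (u *: v)) = `|a| by rewrite linearZ linearZ/= -/a [LHS]divfK.
rewrite rnormKE -fu; apply: (support_derivative fx fb) => [||t t0]; rewrite ?rnorm_ge0//.
have tv : rnorm (x n + of_real k t *: (u *: v)) <= rnorm (x n) + t * rnorm v.
  apply: le_trans (rnormD _ _) _.
  by rewrite lerD2l (rnormZr _ (ltW t0)) rnormZ u1 to_real1 mul1r.
have := @rnorm_lpsum_swap _ _ _ _ hp n (x + of_real k t *: single (u *: v)) x.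
rewrite x1 powR1 lpsumDE lpsumZE singleE => swap; apply/shift_le/swap.
  by apply: ge0_ler_powR; rewrite ?nnegrE ?(ltW p0)// ?(le_trans _ tv)// rnorm_ge0.
by move=> i ni; rewrite lpsumDE lpsumZE single_out// scaler0 addr0.
Qed.

Let swap_zero (a b c d : R) : a - b = c - d -> b = 0 -> c = 1 -> a = 1 - d.
Proof. by lra. Qed.

Let expand (a s s' q qs b d c : R) : a - s' = q - qs -> s' = s ->
  q = c -> qs = c * s -> d = c * b -> b = 1 - s -> a <= 1 - b + d.
Proof. by move=> H es eq eqs ed eb; move: H; rewrite es eq eqs ed eb; lra. Qed.

(** The previous bound at v = x_n gives |a| <= |x_n|^p. For the reverse, let [y] be [x] with
    coordinate [n] erased: the derivative bound in the direction [y] gives Re f(y) <= |y|^p = 1 -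
    |x_n|^p, while f(y) = 1 - a. So [a] is real and equals |x_n|^p. *)
Lemma support_single_eq x f n : rnorm x = 1 -> f x = 1 ->
  (forall z, rnorm (f z) <= rnorm z) ->
  f (single (x n)) = of_real k (rnorm (x n) `^ p).
Proof.
move=> x1 fx fb; set a : K := f (single (x n)).
have [y [yn yi fy]] :
    exists y, [/\ y n = 0, forall i, i != n -> y i = x i & f y = 1 - a].
  exists (x - single (x n)); split=> [|i ni|].
  - by rewrite lpsumDE lpsumNE singleE subrr.
  - by rewrite lpsumDE lpsumNE single_out// subr0.
  - by rewrite linearB fx.
have yp : rnorm y `^ p = 1 - rnorm (x n) `^ p.
  apply: swap_zero (rnorm_lpsum_swap yi) _ _; last by rewrite x1 powR1.
  by rewrite yn rnorm0 powR0 ?gt_eqF.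
have upper : to_real `|a| <= rnorm (x n) `^ p.
  by rewrite (powRS _ p0) ?rnorm_ge0// mulrC; exact: support_single_le.
have lower : rnorm (x n) `^ p <= to_real a.
  suff : to_real (f y) <= rnorm y `^ (p - 1) * rnorm y.
    rewrite mulrC -powRS ?rnorm_ge0// yp fy to_realB to_real1.
    by rewrite lerD2l lerN2.
  (* Here s = r = |y|: off [n] the vector x + t y is (1 + t) x, and at [n] it is still x_n. *)
  apply: (support_derivative fx fb) => [||t t0]; rewrite ?rnorm_ge0//.
  have t1 : 0 <= 1 + t by rewrite addr_ge0// ltW.
  have -> : rnorm y + t * rnorm y = (1 + t) * rnorm y by rewrite mulrDl mul1r.
  have agree i : i != n -> (x + of_real k t *: y) i = (of_real k (1 + t) *: x) i.
    move=> ni; rewrite lpsumDE !lpsumZE yi//.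
    by rewrite of_realD of_real1 scalerDl scale1r.
  have xyn : (x + of_real k t *: y) n = x n.
    by rewrite lpsumDE lpsumZE yn scaler0 addr0.
  apply: (expand (rnorm_lpsum_swap agree) _ _ _ _ yp).
  - by rewrite xyn.
  - by rewrite (rnormZr _ t1) x1 mulr1.
  - by rewrite lpsumZE (rnormZr _ t1) powRM// rnorm_ge0.
  - by rewrite powRM ?rnorm_ge0.
have ra : to_real a = rnorm (x n) `^ p.
  by apply/eqP; rewrite eq_le lower (le_trans (to_real_le_norm _) upper).
by rewrite -ra; apply: to_real_norm_eq; rewrite ra.
Qed.

(** The restriction has norm at most w = |x_n|^(p-1) and value w |x_n| at x_n; since w > 0, division
    by w normalizes it. *)
Lemma support_coordinate x f n : rnorm x = 1 -> J x f -> x n != 0 ->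
  J (x n) (of_real k (rnorm (x n) `^ (p - 1))^-1 \*: (f \o single_lin n)).
Proof.
move=> x1 Jf xn0; have xn := rnorm_gt0 xn0.
have fx : f x = 1 by rewrite (J_apply Jf) x1 of_real1.
have fb z : rnorm (f z) <= rnorm z by exact: J_bound Jf.
have w0 : 0 < rnorm (x n) `^ (p - 1) by exact: powR_gt0.
apply: mem_J => // [v|] /=.
  rewrite (@rnormZr _ _ K^o) ?invr_ge0 ?(ltW w0)// mulrC ler_pdivrMr// mulrC.
  exact: support_single_le.
rewrite support_single_eq// [LHS]/GRing.scale/= -of_realM; congr (of_real k _).
by rewrite (powRS _ p0) ?rnorm_ge0// mulrCA mulVf ?mulr1// gt_eqF.
Qed.

Lemma support_diff_single x f g n c (v : X n) : rnorm x = 1 -> J x f -> J x g ->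
  (calD (X n) <= c%:E)%E ->
  rnorm (f (single v) - g (single v)) <= rnorm (x n) `^ (p - 1) * (c * rnorm v).
Proof.
move=> x1 Jf Jg Dc.
have fx h : J x h -> h x = 1 by move=> /J_apply ->; rewrite x1 of_real1.
(* If x_n = 0, no normalized restriction is available, but the weight 0^(p-1) = 0 forces both
   functionals to vanish on this coordinate. *)
have [xn0|xn0] := eqVneq (x n) 0.
  have h0 h : J x h -> h (single v) = 0.
    move=> Jh; apply: rnorm_eq0; apply/le_anti; rewrite rnorm_ge0 andbT.
    have := @support_single_le x h n v x1 (fx _ Jh) (fun z => J_bound z Jh).
    by rewrite xn0 rnorm0 powR0 ?gt_eqF// mul0r.
  by rewrite !h0// subr0 rnorm0 xn0 rnorm0 powR0 ?gt_eqF// mul0r.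
have w0 : 0 < rnorm (x n) `^ (p - 1) by rewrite powR_gt0 ?rnorm_gt0.
have := J_diff_bound v xn0 Dc (support_coordinate x1 Jf xn0)
  (support_coordinate x1 Jg xn0).
rewrite /= -scalerBr (@rnormZr _ _ K^o) ?invr_ge0 ?(ltW w0)//.
by rewrite mulrC ler_pdivrMr// mulrC.
Qed.

Lemma lpsum_neq0 x : x != 0 -> exists n, x n != 0.
Proof.
move=> x0; apply/not_existsP => H; move/eqP: x0; apply; apply: lpsum_eqP => n.
by have /negP/negPn/eqP -> := H n.
Qed.

End lp_sum_support.

(** * Weighted Young inequality for finite sums *)

Section young_sums.
Variables (R : realType) (p : R) (hp : 1 < p).
Local Notation q := (p / (p - 1)).
Let p0 : 0 < p. Proof. exact: lt_trans hp. Qed.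
Let pB0 : 0 < p - 1. Proof. by rewrite subr_gt0. Qed.
Let q0 : 0 < q. Proof. exact: divr_gt0. Qed.

Let qVp : q^-1 + p^-1 = 1.
Proof. by field; rewrite !gt_eqF. Qed.

(** Young's inequality for s^(p-1) c/2 and [u], using (p-1) q = p. The factor 2 is taken out so that
    c/2 <= 1 when c <= 2. *)
Lemma young_weighted (s c u : R) : 0 <= s -> 0 <= c -> 0 <= u ->
  s `^ (p - 1) * (c * u) <=
  2 * (s `^ p * (c / 2) `^ q / q + u `^ p / p).
Proof.
move=> s0 c0 u0; have c20 : 0 <= c / 2 by rewrite divr_ge0.
have := @conjugate_powR R (s `^ (p - 1) * (c / 2)) u q p
  (mulr_ge0 (powR_ge0 _ _) c20) u0 q0 p0 qVp.
rewrite powRM ?powR_ge0// -powRrM.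
have -> : (p - 1) * q = p by field; rewrite gt_eqF.
rewrite -(@ler_pM2l _ 2)//; apply: le_trans.
by rewrite le_eqVlt; apply/orP; left; apply/eqP; field.
Qed.

(** After Young, each factor (c_i/2)^q is bounded by 1 except at [N], where it is kept; this one
    coordinate produces the gap below 2, and 1/q + 1/p = 1 collects the rest. *)
Lemma young_sum_le (s c u : nat -> R) N m : (N < m)%N ->
  (forall i, 0 <= s i) -> (forall i, 0 <= u i) -> (forall i, 0 <= c i <= 2) ->
  \sum_(i < m) s i `^ p <= 1 -> \sum_(i < m) u i `^ p <= 1 ->
  \sum_(i < m) s i `^ (p - 1) * (c i * u i) <=
  2 * (1 - s N `^ p * (1 - (c N / 2) `^ q) / q).
Proof.
move=> Nm s0 u0 c02 sle ule.
apply: (@le_trans _ _ (\sum_(i < m) 2 * (s i `^ p * (c i / 2) `^ q / q + u i `^ p / p))).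
  by apply: ler_sum => i _; apply: young_weighted => //; have /andP[] := c02 i.
rewrite -mulr_sumr ler_pM2l// big_split/= -!mulr_suml.
pose j := Ordinal Nm.
have : \sum_(i < m) s i `^ p * (c i / 2) `^ q <= 1 - s N `^ p * (1 - (c N / 2) `^ q).
  rewrite (bigD1 j)//= in sle; rewrite (bigD1 j)//=.
  have : \sum_(i < m | i != j) s i `^ p * (c i / 2) `^ q <=
      \sum_(i < m | i != j) s i `^ p.
    apply: ler_sum => i _; rewrite ler_piMr ?powR_ge0//.
    have /andP[ci0 ci2] := c02 i.
    apply: powR_le1 => //; lra.
  by move: sle; move: (\sum_(i < m | _) _) (\sum_(i < m | _) _) => a b; lra.
move=> h.
have qi0 : 0 < q^-1 by rewrite invr_gt0.
have pi0 : 0 < p^-1 by rewrite invr_gt0.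
rewrite -(ler_pM2r qi0) in h; rewrite -(ler_pM2r pi0) in ule.
by move: h ule qVp; lra.
Qed.

Lemma young_sum_bound_lt (s c : R) : 0 < s -> 0 <= c < 2 ->
  2 * (1 - s `^ p * (1 - (c / 2) `^ q) / q) < 2.
Proof.
move=> s0 /andP[c0 c2].
have cq : (c / 2) `^ q < 1 by apply: powR_lt1 => //; lra.
have : 0 < s `^ p * (1 - (c / 2) `^ q) / q.
  by rewrite divr_gt0// mulr_gt0 ?powR_gt0// subr_gt0.
by lra.
Qed.

End young_sums.

(** * Diameters of sets of support functionals in the p-sum *)

Section diameters.
Variables (R : realType) (k : scalar_kind).
Variable X : nat -> normedModType (scalars R k).
Variables (p : R) (hp : 1 < p).
Local Notation K := (scalars R k).
Local Notation T := (lpsum X (ltW hp)).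
Implicit Types (x y z : T) (n m : nat).

Let p0 : 0 < p. Proof. exact: lt_trans hp. Qed.

Lemma D_lt2_of_norm1 x (c : nat -> R) : rnorm x = 1 ->
  (forall n, 0 <= c n < 2) -> (forall n, (calD (X n) <= (c n)%:E)%E) ->
  (D x < 2%:E)%E.
Proof.
move=> x1 c02 Dc.
have x0 : x != 0 by apply: contra_eq_neq x1 => ->; rewrite rnorm0 eq_sym oner_eq0.
have [N xN0] := lpsum_neq0 x0.
(* [B] depends on neither the functionals nor the test vector, so the strict inequality survives
   both suprema. *)
set B := 2 * (1 - rnorm (x N) `^ p * (1 - (c N / 2) `^ (p / (p - 1))) / (p / (p - 1))).
apply: (@le_lt_trans _ _ B%:E); last first.
  by rewrite lte_fin /B; apply: young_sum_bound_lt => //; exact: rnorm_gt0.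
apply: ge_ereal_sup => _ [f Jf [g Jg <-]].
apply: ge_ereal_sup => _ [y /= y1 <-]; rewrite lee_fin.
apply/ler_addgt0Pr => e e0.
have e20 : 0 < e / 2 by rewrite divr_gt0.
(* The difference of the functionals has norm at most 2, so a tail of size e/2 costs at most [e].
   Taking m > N keeps the gap coordinate in the finite sum. *)
have [m [Nm tail]] : exists m, (N < m)%N /\ rnorm (y - truncation m y) <= e / 2.
  have [M _ HM] := truncation_near y e20.
  exists (maxn M N.+1); split; first exact: leq_maxr.
  by apply: HM => /=; exact: leq_maxl.
pose h : {linear T -> K^o} := f \- g.
have hE z : f z - g z = h z by [].
have hb z : rnorm (h z) <= 2 * rnorm z.
  have -> : 2 * rnorm z = rnorm z + rnorm z by ring.
  apply: le_trans (@rnormD _ _ K^o (f z) (- g z)) _.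
  have -> : rnorm (- g z : K^o) = rnorm (g z) by rewrite /rnorm normrN.
  by rewrite lerD// (J_bound _ Jf, J_bound _ Jg).
rewrite hE -[in X in rnorm X](subrK (truncation m y) y) addrC linearD.
apply: le_trans (@rnormD _ _ K^o _ _) _; apply: lerD; last first.
  by apply: le_trans (hb _) _; rewrite -ler_pdivlMl// mulrC.
rewrite /truncation linear_sum.
apply: (@le_trans _ _ (\sum_(i < m) rnorm (h (single hp (y i))))).
  elim/big_rec2 : _ => [|i a b _ ab]; first by rewrite rnorm0.
  by apply: le_trans (@rnormD _ _ K^o _ _) _; rewrite lerD2l.
apply: (@le_trans _ _ (\sum_(i < m) rnorm (x i) `^ (p - 1) * (c i * rnorm (y i)))).
  by apply: ler_sum => i _; rewrite -hE; exact: support_diff_single.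
apply: (@young_sum_le R p hp (fun i => rnorm (x i)) c (fun i => rnorm (y i))) => //.
- by move=> i; exact: rnorm_ge0.
- by move=> i; exact: rnorm_ge0.
- by move=> i; have /andP[-> /ltW] := c02 i.
- by apply: le_trans (sum_coordinates_le x m) _; rewrite x1 powR1.
- by apply: le_trans (sum_coordinates_le y m) _; rewrite powR_le1 ?rnorm_ge0.
Qed.

Lemma D_lt2 x (c : nat -> R) : x != 0 ->
  (forall n, 0 <= c n < 2) -> (forall n, (calD (X n) <= (c n)%:E)%E) ->
  (D x < 2%:E)%E.
Proof.
move=> x0 c02 Dc; have nx : 0 < (rnorm x)^-1 by rewrite invr_gt0 rnorm_gt0.
apply: le_lt_trans (D_scale x nx) _; apply: D_lt2_of_norm1 c02 Dc.
by rewrite (rnormZr _ (ltW nx)) mulVf// gt_eqF// rnorm_gt0.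
Qed.

Lemma single_neq0 n (v : X n) : v != 0 -> single hp v != 0.
Proof.
apply: contra_neq => s0; apply: rnorm_eq0.
by rewrite -(rnorm_single hp v) s0 rnorm0.
Qed.

(** Composing with the coordinate projection, of norm at most 1, sends [J v] into [J] of the
    embedded vector. Differences do not lose norm, since the embedding maps the unit ball of [X n]
    into that of the sum. *)
Lemma D_single_ge n (v : X n) : v != 0 -> (D v <= D (single hp v))%E.
Proof.
move=> v0.
have s0 := single_neq0 v0.
pose lift (f : {linear X n -> K^o}) : {linear T -> K^o} := f \o @coordinate _ _ _ _ hp n.
have coordE w : coordinate n (single hp w) = w by exact: singleE.
have Jlift f : J v f -> J (single hp v) (lift f).
  move=> Jf; apply: mem_J => // [y|].
    exact: le_trans (J_bound _ Jf) (rnorm_coordinate_le _ _).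
  by rewrite rnorm_single -(J_apply Jf); congr (f _); exact: coordE.
apply: ge_ereal_sup => _ [f Jf [g Jg <-]].
apply: (@le_trans _ _ (opnorm (fun y => lift f y - lift g y))).
  apply: ge_ereal_sup => _ [w /= w1 <-]; apply: ereal_sup_ubound => /=.
  exists (single hp w); first by rewrite /= rnorm_single.
  by rewrite !coordE.
apply: ereal_sup_ubound => /=; exists (lift f); first exact: Jlift.
by exists (lift g); first exact: Jlift.
Qed.

Lemma calD_le_lpsum n : (calD (X n) <= calD T)%E.
Proof.
apply: ge_ereal_sup => _ [v /= v0 <-]; apply: le_trans (D_single_ge v0) _.
apply: ereal_sup_ubound; exists (single hp v) => //=.
exact: single_neq0.
Qed.

End diameters.

Theorem proposition13 (R : realType) (k : scalar_kind)
    (X : nat -> completeNormedModType (scalars R k))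
    (hX : forall n : nat, calD (X n) = (2 - n.+1%:R^-1)%:E)
    (p : R) (hp : 1 < p) :
  (forall x : lpsum (fun n => X n) (ltW hp), x != 0 -> (D x < 2%:E)%E) /\
  calD (lpsum (fun n => X n) (ltW hp)) = 2%:E.
Proof.
(* Indices start at 0, so 1/n becomes 1/(n+1) and the constants 2 - 1/(n+1) lie in [1, 2[. *)
have inv01 n : 0 < (n.+1%:R^-1 : R) <= 1.
  by rewrite invr_gt0 ltr0n invf_le1 ?ltr0n// ler1n.
have lt2 (x : lpsum (fun n => X n) (ltW hp)) : x != 0 -> (D x < 2%:E)%E.
  move=> x0; apply: (D_lt2 (c := fun n => 2 - n.+1%:R^-1)) => // n; last first.
    by rewrite hX.
  have /andP[i0 i1] := inv01 n; rewrite subr_ge0 gtrBl i0 andbT.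
  by rewrite (le_trans i1)// ler1n.
split=> //; apply/eqP; rewrite eq_le; apply/andP; split.
  by apply: ge_ereal_sup => _ [x /= x0 <-]; exact/ltW/lt2.
have ge n : ((2 - n.+1%:R^-1)%:E <= calD (lpsum (fun n => X n) (ltW hp)))%E.
  by rewrite -hX; exact: calD_le_lpsum.
case: (calD _) ge => [r| |] ge; rewrite ?leey//; last by have := ge 0%N.
(* Archimedean property: r < 2 would give r + 1/(n+1) < 2 for some [n], against the lower bound at
   [n]. *)
rewrite lee_fin leNgt; apply/negP => /ltr_add_invr[n].
by rewrite -ltrBrDr ltNge -lee_fin ge.
Qed.
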